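(* Let $V$ be an $n$-dimensional real vector space with a direct sum decomposition $V = V_1 \oplus \cdots \oplus V_r$. Let $\mathcal{P}=\{(A_i,B_i):i\in[m]\}$ be a collection of pairs of subspaces of $V$ such that (i) $\dim(A_i\cap B_i)=0$ for every $i\in[m]$, and (ii) $\dim(A_i\cap B_j)>0$ for all $i<j$ in $[m]$. Suppose moreover that for each $i\in[m]$, $A_i = \bigoplus_{k=1}^r (A_i \cap V_k)$ and $B_i = \bigoplus_{k=1}^r (B_i \cap V_k)$. For $i\in[m]$ and $k\in[r]$ set $a_{i,k}=\dim(A_i\cap V_k)$ and $b_{i,k}=\dim(B_i\cap V_k)$. Then $$\sum_{i=1}^{m}\left[\prod_{k=1}^{r}\binom{a_{i,k}+b_{i,k}}{a_{i,k}}(1+a_{i,k}+b_{i,k})\right]^{-1}\le 1.$$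
   Context: $[m]=\{1,\ldots,m\}$. A collection satisfying (i) and (ii) is called a skew Bollobás system of subspaces. *)

(* Defs.v *)
From mathcomp Require Import all_boot all_order all_algebra.
Set Implicit Arguments.
Unset Strict Implicit.
Unset Printing Implicit Defensive.
Import GRing.Theory.

(* [directv] only says that the sum is direct, not what it is equal to. *)
Definition is_direct_sum (K : fieldType) (vT : vectType K) (r : nat)
    (U : {vspace vT}) (W : 'I_r -> {vspace vT}) : Prop :=
  U = (\sum_(k < r) W k)%VS /\ directv (\sum_(k < r) W k).

Definition skew_bollobas (K : fieldType) (vT : vectType K) (m : nat)
    (A B : 'I_m -> {vspace vT}) : Prop :=
  (forall i, \dim (A i :&: B i) = 0%N) /\
  (forall i j : 'I_m, (i < j)%N -> (0 < \dim (A i :&: B j))%N).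

(* Main.v *)
(* Write A_k, B_k for the intersections of A, B with V_k. If v in V_k lies
   outside A_k + B_k, the pair (A, B) may be replaced by the two pairs in which
   v is added to A, respectively to B: the first new pair meets the second in v,
   so the system stays skew, and the total weight is unchanged because the
   numbers w(a, b) = 1 / ((1 + a + b) C(a + b, a)) satisfy the harmonic triangle
   identity w(a, b) = w(a + 1, b) + w(a, b + 1). So one may assume
   A_k + B_k = V_k throughout. For fixed dimensions c_k = dim A_k, the matrix
   whose (i, j) entry is the product over k of the determinants pairing A_(i,k)
   with equations of B_(j,k) is triangular with nonzero diagonal, and by
   Cauchy-Binet it factors through dimension prod_k C(n_k, c_k), where
   n_k = dim V_k. Hence at most that many pairs have these dimensions, and
   C(n_k, c) w(c, n_k - c) = 1 / (n_k + 1) sums to 1 over 0 <= c <= n_k. *)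

Require Import Defs.
From mathcomp Require Import all_boot all_order all_algebra all_fingroup.
From mathcomp Require Import reals zify ring.
Set Implicit Arguments.
Unset Strict Implicit.
Unset Printing Implicit Defensive.
Import Order.TTheory GRing.Theory Num.Theory.
Local Open Scope ring_scope.

(** * The Cauchy-Binet formula *)

Lemma det_mulmx_expand (R : comPzRingType) (a n : nat)
    (A : 'M[R]_(a, n)) (C : 'M[R]_(n, a)) :
  \det (A *m C) =
  \sum_(f : {ffun 'I_a -> 'I_n}) (\prod_i A i (f i)) * \det (rowsub f C).
Proof.
pose AC (s : 'S_a) i j := A i j * C j (s i).
transitivity (\sum_(f : {ffun _ -> _}) \sum_(s : 'S_a)
    (-1) ^+ s * \prod_i AC s i (f i)).
  rewrite exchange_big; apply: eq_bigr => /= s _; rewrite -big_distrr /=.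
  congr (_ * _); rewrite -(bigA_distr_bigA (AC s)) /=.
  by apply: eq_bigr => i _; rewrite mxE.
apply: eq_bigr => f _; rewrite big_distrr /=; apply: eq_bigr => s _.
rewrite mulrCA big_split //=; congr (_ * (_ * _)).
by apply: eq_bigr => i _; rewrite mxE.
Qed.

Lemma det_row_perm (R : comPzRingType) (n : nat) (s : 'S_n) (A : 'M[R]_n) :
  \det (row_perm s A) = (-1) ^+ s * \det A.
Proof. by rewrite row_permE det_mulmx det_perm. Qed.

(** An injective [f] is an increasing tuple [t] composed with a permutation. For fixed [t], the sum
    over permutations rebuilds the minor of [A], the signs coming from reordering the rows of
    [C]. *)
Lemma Cauchy_Binet (R : comPzRingType) (a n : nat)
    (A : 'M[R]_(a, n)) (C : 'M[R]_(n, a)) :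
  \det (A *m C) =
  \sum_(t : a.-tuple 'I_n | sorted ltn (map val t))
    \det (colsub (tnth t) A) * \det (rowsub (tnth t) C).
Proof.
pose leI := relpre (val : 'I_n -> nat) leq.
have sortedE (s : seq 'I_n) : sorted ltn (map val s) = uniq s && sorted leI s.
  by rewrite ltn_sorted_uniq_leq map_inj_uniq ?sorted_map //; apply: val_inj.
have leI_total : total leI by move=> i j; apply: leq_total.
have leI_trans : transitive leI by move=> j i k; apply: leq_trans.
have leI_anti : antisymmetric leI.
  by move=> i j /anti_leq /val_inj.
pose graph (f : {ffun 'I_a -> 'I_n}) := [tuple f i | i < a].
pose p f : a.-tuple 'I_n := [tuple of sort leI (graph f)].
have uniq_graph f : uniq (graph f) = injectiveb f.
  by [].
rewrite det_mulmx_expand (bigID (fun f : {ffun _} => injectiveb f)) /= addrC.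
(* A non-injective [f] repeats a row of [C], so its determinant vanishes. *)
rewrite big1 ?add0r => [|f /injectivePn [i1 [i2 ne12 eq12]]]; last first.
  rewrite (determinant_alternate ne12) ?mulr0 // => j.
  by rewrite !mxE eq12.
rewrite (partition_big p (fun t => sorted ltn (map val t))) /=; last first.
  by move=> f; rewrite sortedE sort_uniq uniq_graph sort_sorted // => ->.
apply: eq_bigr => t; rewrite sortedE => /andP[t_uniq t_sorted].
pose h (s : 'S_a) : {ffun 'I_a -> 'I_n} := [ffun i => tnth t (s i)].
have tI : injective (tnth t) by apply/tuple_uniqP.
have hI : injective h.
  move=> s1 s2 /ffunP eq_h; apply/permP=> i; apply: tI.
  by have := eq_h i; rewrite !ffunE.
have h_onto (f : {ffun 'I_a -> 'I_n}) :
    injectiveb f -> p f == t -> exists s, h s == f.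
  move=> f_inj /eqP pf.
  have /tuple_permP[s def_s] : perm_eq (graph f) t.
    by rewrite -pf perm_sym perm_sort.
  exists s; apply/eqP/ffunP=> i; rewrite ffunE.
  rewrite -[RHS](tnth_mktuple f) -/(graph f).
  have -> : graph f = [tuple tnth t (s j) | j < a] by apply/val_inj.
  by rewrite tnth_mktuple.
have h_cond s : injectiveb (h s) && (p (h s) == t).
  have h_inj : injectiveb (h s).
    by apply/injectiveP=> i j; rewrite !ffunE => /tI /perm_inj.
  have graph_h : perm_eq (graph (h s)) t.
    have -> : graph (h s) = [tuple tnth t (s i) | i < a].
      by apply/eq_from_tnth=> i; rewrite !tnth_mktuple ffunE.
    by apply/tuple_permP; exists s.
  rewrite h_inj; apply/eqP/val_inj.
  apply: (sorted_eq leI_trans leI_anti) => //; first exact: sort_sorted.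
  by rewrite perm_sort.
rewrite (reindex h); last first.
  (* On the range of summation [h_onto] supplies a preimage, so the default [1%g] is never reached
     there. *)
  exists (fun f => odflt 1%g [pick s | h s == f]) => [s _ | f] /=.
    by case: pickP => [s' /eqP /hI -> // | /(_ s)]; rewrite eqxx.
  rewrite inE => /andP[f_inj /(h_onto _ f_inj) [s hs]].
  by case: pickP => [s' /eqP // | /(_ s)]; rewrite hs.
rewrite big_distrl /=; apply: eq_big => [s | s _]; first by rewrite h_cond.
have -> : rowsub (h s) C = row_perm s (rowsub (tnth t) C).
  by apply/matrixP=> i j; rewrite !mxE ffunE.
rewrite det_row_perm mulrA [_ * (-1) ^+ s]mulrC; congr (_ * _ * _).
by apply: eq_bigr => i _; rewrite !mxE ffunE.
Qed.

(** * Determinants pairing subspaces of complementary dimension *)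

(** With [D] a complement of [B] in [W], the columns of [C] are the coordinates of the projection
    onto [D] along [B], whose kernel in [W] is [B]. *)
Lemma subspace_equations (K : fieldType) (vT : vectType K) (W B : {vspace vT})
    (a : nat) :
  (B <= W)%VS -> \dim W = (a + \dim B)%N ->
  exists C : 'M[K]_(\dim W, a),
    forall w, w \in W ->
      ((\row_j coord (vbasis W) j w) *m C == 0) = (w \in B).
Proof.
move=> sBW dimW; set D := (W :\: B)%VS.
have DB0 : (D :&: B = 0)%VS := capv_diff W B.
have DBW : (D + B = W)%VS by rewrite addv_diff (addv_idPl sBW).
have dimD : \dim D = a.
  apply/eqP; rewrite -(eqn_add2r (\dim B)) -dimW.
  by rewrite -(dimv_disjoint_sum DB0) DBW.
have [X X_basis] : exists X : a.-tuple vT, basis_of D X.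
  by rewrite -dimD; exists (vbasis D); apply: vbasisP.
exists (\matrix_(j, l) coord X l (daddv_pi D B (vbasis W)`_j)) => w wW.
have coordE l : ((\row_j coord (vbasis W) j w) *m
    \matrix_(j, l) coord X l (daddv_pi D B (vbasis W)`_j)) 0 l =
    coord X l (daddv_pi D B w).
  rewrite [in RHS](coord_vbasis wW) !linear_sum mxE; apply: eq_bigr => j _.
  by rewrite !linearZ !mxE.
have -> : (w \in B) = (daddv_pi D B w == 0).
  have pi_add : daddv_pi D B w + daddv_pi B D w = w.
    by apply: daddv_pi_add => //; rewrite DBW.
  apply/idP/eqP => [wB | pi0].
    move: pi_add; rewrite (daddv_pi_id _ wB) 1?capvC // => /eqP.
    by rewrite -subr_eq0 addrK => /eqP.
  by rewrite -pi_add pi0 add0r memv_pi.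
apply/eqP/eqP => [eq0 | pi0].
  rewrite (coord_basis X_basis (memv_pi D B w)) big1 // => l _.
  by rewrite -coordE eq0 mxE scale0r.
by apply/rowP=> l; rewrite coordE pi0 linear0 mxE.
Qed.

(** The rows of [M] are the coordinates of a basis of [A], so left kernel vectors of [M *m C]
    correspond to elements of [A :&: B]. [M] is chosen before [C] and [B]: a single matrix for [A]
    has to serve every [B j] in the pairing. *)
Lemma subspace_rows (K : fieldType) (vT : vectType K) (W A : {vspace vT})
    (a : nat) :
  (A <= W)%VS -> \dim A = a ->
  exists M : 'M[K]_(a, \dim W),
    forall (C : 'M[K]_(\dim W, a)) (B : {vspace vT}),
    (forall w, w \in W ->
      ((\row_j coord (vbasis W) j w) *m C == 0) = (w \in B)) ->
    (\det (M *m C) != 0) = ((A :&: B)%VS == 0%VS).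
Proof.
move=> sAW dimA.
have [X X_basis] : exists X : a.-tuple vT, basis_of A X.
  by rewrite -dimA; exists (vbasis A); apply: vbasisP.
pose M := \matrix_(i < a, j < \dim W) coord (vbasis W) j X`_i.
have XA (x : 'rV_a) : (\sum_i x 0 i *: X`_i)%R \in A.
  apply: rpred_sum => i _; apply: rpredZ; apply: (basis_mem X_basis).
  by rewrite mem_nth // size_tuple.
have rowE (x : 'rV_a) :
    x *m M = \row_j coord (vbasis W) j (\sum_i x 0 i *: X`_i).
  apply/rowP=> j; rewrite !mxE linear_sum; apply: eq_bigr => i _.
  by rewrite linearZ mxE.
exists M => C B CB; apply/idP/idP; last first.
  apply: contraTN => /det0P[x nz_x xMC].
  apply/negP=> /eqP AB0; case/negP: nz_x; apply/eqP.
  have /(freeP (basis_free X_basis)) x0 : \sum_i x 0 i *: X`_i = 0.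
    apply/eqP; rewrite -memv0 -AB0 memv_cap XA -CB ?(subvP sAW) //.
    by rewrite -rowE -mulmxA xMC eqxx.
  by apply/rowP=> i; rewrite x0 mxE.
apply: contraR; rewrite -vpick0; set v := vpick _ => nz_v.
have := memv_pick (A :&: B)%VS; rewrite -/v memv_cap => /andP[vA vB].
have v_def := coord_basis X_basis vA.
apply/det0P; exists (\row_i coord X i v).
  apply: contra nz_v => /eqP/rowP coord0; apply/eqP; rewrite v_def.
  by apply: big1 => i _; have := coord0 i; rewrite !mxE => ->; rewrite scale0r.
rewrite mulmxA rowE; apply/eqP; under eq_bigr do rewrite mxE.
by rewrite -v_def CB // (subvP sAW).
Qed.

(** A factorization bounding the rank by [d]. Any finite index type is allowed, so that products of
    factorizations can be indexed by pairs. *)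
Definition factors_through (K : pzRingType) (m d : nat) (M : 'M[K]_m) : Prop :=
  exists (T : finType) (u v : 'I_m -> T -> K),
    #|T| = d /\ forall i j, M i j = \sum_t u i t * v j t.

(** Cauchy-Binet separates [i] from [j]: the factors are the maximal minors (Pluecker coordinates)
    of [A i] and of the equations of [B j]. *)
Lemma complementary_pairing (K : fieldType) (vT : vectType K)
    (W : {vspace vT}) (a m : nat) (A B : 'I_m -> {vspace vT}) :
  (forall i, (A i <= W)%VS) -> (forall i, \dim (A i) = a) ->
  (forall j, (B j <= W)%VS) -> (forall j, \dim W = (a + \dim (B j))%N) ->
  exists M : 'M[K]_m,
    (forall i j, (M i j != 0) = ((A i :&: B j)%VS == 0%VS)) /\
    factors_through 'C(\dim W, a) M.
Proof.
move=> sAW dimA sBW dimB.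
have [C CP] := fin_all_exists (fun j => subspace_equations (sBW j) (dimB j)).
have [N NP] := fin_all_exists (fun i => subspace_rows (sAW i) (dimA i)).
exists (\matrix_(i, j) \det (N i *m C j)); split=> [i j|].
  by rewrite mxE; apply: NP; apply: CP.
pose D := [set t : a.-tuple 'I_(\dim W) | sorted ltn (map val t)].
exists 'I_#|D|.
exists (fun i l => \det (colsub (tnth (enum_val l)) (N i))).
exists (fun j l => \det (rowsub (tnth (enum_val l)) (C j))).
split=> [|i j]; first by rewrite card_ord card_ltn_sorted_tuples.
rewrite mxE Cauchy_Binet.
rewrite -(big_enum_val (fun t =>
  \det (colsub (tnth t) (N i)) * \det (rowsub (tnth t) (C j)))).
by apply: eq_bigl => t; rewrite inE.
Qed.

(** * Rank bounds for entrywise products and triangular matrices *)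

(** A product of sums expands into a sum over tuples of indices, so inner dimensions multiply. *)
Lemma factors_through_prod (K : comPzRingType) (m : nat) (I : finType)
    (d : I -> nat) (M : I -> 'M[K]_m) :
  (forall k, factors_through (d k) (M k)) ->
  factors_through (\prod_k d k) (\matrix_(i, j) \prod_k M k i j).
Proof.
move=> MF; elim: (index_enum I) => [|k r [T [u [v [cardT uvT]]]]].
  exists unit, (fun _ _ => 1), (fun _ _ => 1); rewrite card_unit big_nil.
  by split=> // i j; rewrite mxE big_nil big_const card_unit /= addr0 mulr1.
have [S [x [y [cardS xyS]]]] := MF k.
exists (S * T)%type, (fun i t => x i t.1 * u i t.2),
  (fun j t => y j t.1 * v j t.2).
rewrite card_prod big_cons cardS cardT; split=> // i j.
have := uvT i j; rewrite !mxE big_cons => ->; rewrite xyS big_distrlr /=.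
rewrite pair_bigA /=; apply: eq_bigr => t _.
by rewrite mulrACA.
Qed.

Lemma factors_through_trig (K : fieldType) (m d : nat) (M : 'M[K]_m) :
  factors_through d M -> is_trig_mx M -> (forall i, M i i != 0) -> (m <= d)%N.
Proof.
move=> [T [u [v [<- uvT]]]] M_trig M_diag.
have M_unit : M \in unitmx.
  by rewrite unitmxE unitfE det_trig //; apply/prodf_neq0 => i _.
rewrite -(mxrank_unit M_unit).
have -> : M = (\matrix_(i < m, l < #|T|) u i (enum_val l)) *m
              (\matrix_(l < #|T|, j < m) v j (enum_val l)).
  apply/matrixP=> i j; rewrite uvT mxE (big_enum_val (fun t => u i t * v j t)).
  by apply: eq_bigr => l _; rewrite !mxE.
exact: mulmx_max_rank.
Qed.

(** * Weights from the harmonic triangle *)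

(** An entry of the Leibniz harmonic triangle, equal to the Beta integral of x^a (1-x)^b over
    [0,1]. *)
Definition harmonic_weight (F : numFieldType) (a b : nat) : F :=
  ('C(a + b, a)%:R * (1 + a%:R + b%:R))^-1.

Lemma harmonic_weight_ge0 (F : numFieldType) (a b : nat) :
  0 <= harmonic_weight F a b.
Proof. by rewrite invr_ge0 mulr_ge0 ?ler0n // !addr_ge0 ?ler0n ?ler01. Qed.

Lemma harmonic_weight_fact (F : numFieldType) (a b : nat) :
  harmonic_weight F a b = (a`! * b`!)%:R / (a + b).+1`!%:R.
Proof.
have nz k : k`!%:R != 0 :> F by rewrite pnatr_eq0 -lt0n fact_gt0.
have /(congr1 (fun k => k%:R : F)) := bin_fact (leq_addr b a).
rewrite addKn factS /harmonic_weight !natrM -[1]/(1%:R) -!natrD !addSn add0n.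
move=> <-; rewrite !invfM; have := nz a; have := nz b.
have : 'C(a + b, a)%:R != 0 :> F by rewrite pnatr_eq0 -lt0n bin_gt0 leq_addr.
have : (a + b).+1%:R != 0 :> F by rewrite pnatr_eq0.
by move=> *; field; rewrite -natrD nat1r; apply/and4P; split.
Qed.

Lemma harmonic_weight_split (F : numFieldType) (a b : nat) :
  harmonic_weight F a b = harmonic_weight F a.+1 b + harmonic_weight F a b.+1.
Proof.
rewrite !harmonic_weight_fact addSn addnS -mulrDl -natrD.
have -> : (a.+1`! * b`! + a`! * b.+1`! = a`! * b`! * (a + b).+2)%N.
  by rewrite !factS; nia.
rewrite (factS (a + b).+1); move: ((a + b).+1`!) => f; rewrite !natrM invfM.
have nz : (a + b).+2%:R != 0 :> F by rewrite pnatr_eq0.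
by rewrite [RHS]mulrA mulfK.
Qed.

Lemma harmonic_weight_row (F : numFieldType) (n c : nat) :
  (c <= n)%N -> 'C(n, c)%:R * harmonic_weight F c (n - c) = n.+1%:R^-1.
Proof.
move=> le_cn; rewrite /harmonic_weight subnKC // -addrA -natrD subnKC //.
rewrite -[1]/(1%:R) -natrD add1n invfM mulrA mulfV ?mul1r //.
by rewrite pnatr_eq0 -lt0n bin_gt0.
Qed.

(** * Adding a vector to a subspace *)

Lemma dimv_add_line (K : fieldType) (vT : vectType K) (A : {vspace vT})
    (v : vT) :
  v \notin A -> \dim (A + <[v]>) = (\dim A).+1.
Proof.
move=> vA; have nz_v : v != 0 by apply: contraNneq vA => ->; apply: mem0v.
rewrite dimv_disjoint_sum ?dim_vline ?nz_v ?addn1 //.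
apply/eqP; rewrite -subv0; apply/subvP=> w; rewrite memv_cap => /andP[wA].
case/vlineP=> c def_w; move: wA; rewrite def_w.
have [-> _ | nz_c] := eqVneq c 0; first by rewrite scale0r mem0v.
by rewrite rpredZeq (negPf nz_c) (negPf vA).
Qed.

(** Adding [v] raises the dimensions of [A] and of [A + B] by one each, so the dimension formula
    leaves 0 for the intersection. *)
Lemma capv_add_line (K : fieldType) (vT : vectType K) (A B : {vspace vT})
    (v : vT) :
  (A :&: B)%VS = 0%VS -> v \notin (A + B)%VS -> ((A + <[v]>) :&: B)%VS = 0%VS.
Proof.
move=> AB0 vAB; apply/eqP; rewrite -dimv_eq0.
have vA : v \notin A by apply: contra vAB; apply/subvP/addvSl.
have := dimv_sum_cap (A + <[v]>)%VS B.
rewrite -addvA (addvC <[v]>%VS) addvA !dimv_add_line // dimv_disjoint_sum //.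
by lia.
Qed.

(** * Pairs of families of components *)

Section SubspacePairs.

Variables (K : fieldType) (vT : vectType K).
Variables (I : finType) (V : I -> {vspace vT}).
Variable F : realFieldType.

Local Notation family := {ffun I -> {vspace vT}}.

Implicit Types (p q : family * family) (s : seq (family * family)).

Definition componentwise_disjoint p : bool :=
  [forall k, [&& (p.1 k <= V k)%VS, (p.2 k <= V k)%VS
               & (p.1 k :&: p.2 k)%VS == 0%VS]].

(** Not symmetric: the first member of [p] is tested against the second of [q], so
    [pairwise meets s] is skewness in the order of [s]. *)
Definition meets p q : bool := [exists k, (p.1 k :&: q.2 k)%VS != 0%VS].

(** For a [componentwise_disjoint] pair this says that [p.1 k] and [p.2 k] together fill [V k]. *)
Definition spanning p : bool :=
  [forall k, \dim (V k) == (\dim (p.1 k) + \dim (p.2 k))%N].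

Definition extends p q : bool :=
  [forall k, (p.1 k <= q.1 k)%VS && (p.2 k <= q.2 k)%VS].

Definition weight p : F :=
  \prod_k harmonic_weight F (\dim (p.1 k)) (\dim (p.2 k)).

Definition grow (A : family) (k : I) (v : vT) : family :=
  [ffun l => if l == k then (A l + <[v]>)%VS else A l].

Lemma sub_grow (A : family) k v l : (A l <= grow A k v l)%VS.
Proof. by rewrite ffunE; case: eqP => // _; apply: addvSl. Qed.

Lemma mem_grow (A : family) k v : v \in grow A k v k.
Proof. by rewrite ffunE eqxx (subvP (addvSr _ _)) ?memv_line. Qed.

Lemma componentwise_disjoint_growl (A B : family) k v :
  componentwise_disjoint (A, B) -> v \in V k -> v \notin (A k + B k)%VS ->
  componentwise_disjoint (grow A k v, B).
Proof.
move=> /forallP disj vV vAB; apply/forallP=> l.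
have /and3P[/= sAV sBV /eqP AB0] := disj l.
rewrite /= ffunE sBV; case: eqP => [eq_lk | _]; last by rewrite sAV AB0 eqxx.
rewrite eq_lk in sAV sBV AB0 *.
by rewrite subv_add sAV capv_add_line //= eqxx andbT.
Qed.

Lemma componentwise_disjointC (A B : family) :
  componentwise_disjoint (A, B) = componentwise_disjoint (B, A).
Proof. by apply: eq_forallb => k /=; rewrite andbCA capvC. Qed.

Lemma componentwise_disjoint_growr (A B : family) k v :
  componentwise_disjoint (A, B) -> v \in V k -> v \notin (A k + B k)%VS ->
  componentwise_disjoint (A, grow B k v).
Proof.
rewrite addvC componentwise_disjointC [in X in _ -> X]componentwise_disjointC.
exact: componentwise_disjoint_growl.
Qed.

Lemma extends_trans : transitive extends.
Proof.
move=> q p o /forallP pq /forallP qo; apply/forallP=> k.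
have /andP[p1 p2] := pq k; have /andP[q1 q2] := qo k.
by rewrite (subv_trans p1) ?(subv_trans p2).
Qed.

Lemma extends_refl : reflexive extends.
Proof. by move=> p; apply/forallP=> k; rewrite !subvv. Qed.

Lemma meets_extends p p' q q' :
  extends p p' -> extends q q' -> meets p q -> meets p' q'.
Proof.
move=> /forallP pp' /forallP qq' /existsP[k pq]; apply/existsP; exists k.
have /andP[p1 _] := pp' k; have /andP[_ q2] := qq' k.
by apply: contra pq; rewrite -!subv0; apply: subv_trans; apply: capvS.
Qed.

Lemma weight_split (A B : family) k v :
  v \notin (A k + B k)%VS ->
  weight (A, B) = weight (grow A k v, B) + weight (A, grow B k v).
Proof.
move=> vAB; rewrite /weight !(bigD1 k (P := xpredT)) //= !ffunE eqxx.
have vA : v \notin A k by apply: contra vAB; apply/subvP/addvSl.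
have vB : v \notin B k by apply: contra vAB; apply/subvP/addvSr.
rewrite !dimv_add_line //.
rewrite harmonic_weight_split mulrDl; congr (_ * _ + _ * _).
  by apply: eq_bigr => l /negPf lk; rewrite ffunE lk.
by apply: eq_bigr => l /negPf lk; rewrite ffunE lk.
Qed.

(** * Saturation to spanning pairs *)

Definition defect p : nat :=
  \sum_k (\dim (V k) - (\dim (p.1 k) + \dim (p.2 k))).

(** Subtraction is truncated, so the strict drop at [k] requires room in [V k] before the
    extension. *)
Lemma defect_lt p q k :
  extends p q ->
  (\dim (p.1 k) + \dim (p.2 k) < \dim (q.1 k) + \dim (q.2 k))%N ->
  (\dim (p.1 k) + \dim (p.2 k) < \dim (V k))%N ->
  (defect q < defect p)%N.
Proof.
move=> /forallP pq lt_pq lt_pV.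
rewrite /defect !(bigD1 k (P := xpredT)) //= -addSn leq_add //; first by lia.
by apply: leq_sum => l _; have /andP[/dimvS ? /dimvS ?] := pq l; lia.
Qed.

(** Induction on [defect], branching on the side that receives a missing vector. Every output
    extends [p], and so inherits its intersections with other pairs. *)
Lemma saturate p : componentwise_disjoint p ->
  exists s, [/\ all componentwise_disjoint s, all spanning s,
    all (extends p) s, pairwise meets s & \sum_(q <- s) weight q = weight p].
Proof.
have [n] := ubnP (defect p); elim: n p => // n IHn p.
rewrite ltnS => le_pn disj_p.
have [span_p | /forallPn[k ndim]] := boolP (spanning p).
  by exists [:: p]; rewrite big_seq1 /= disj_p span_p extends_refl.
case: p => A B /= in le_pn disj_p ndim *.
have /and3P[/= sAV sBV /eqP AB0] := forallP disj_p k.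
have sABV : (A k + B k <= V k)%VS by rewrite subv_add sAV.
have lt_dim : (\dim (A k) + \dim (B k) < \dim (V k))%N.
  by rewrite ltn_neqAle eq_sym ndim -dimv_disjoint_sum // dimvS.
have /subvPn[v vV vAB] : ~~ (V k <= A k + B k)%VS.
  by apply: contraL lt_dim => /dimvS; rewrite dimv_disjoint_sum // leqNgt.
have vA : v \notin A k by apply: contra vAB; apply/subvP/addvSl.
have vB : v \notin B k by apply: contra vAB; apply/subvP/addvSr.
have ext1 : extends (A, B) (grow A k v, B).
  by apply/forallP=> l; rewrite /= sub_grow subvv.
have ext2 : extends (A, B) (A, grow B k v).
  by apply/forallP=> l; rewrite /= sub_grow subvv.
have [||s1 [disj1 span1 exts1 meet1 sum1]] := IHn (grow A k v, B).
- apply: leq_trans le_pn; apply: (defect_lt (k := k)) => //=.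
  by rewrite ffunE eqxx dimv_add_line.
- exact: componentwise_disjoint_growl.
have [||s2 [disj2 span2 exts2 meet2 sum2]] := IHn (A, grow B k v).
- apply: leq_trans le_pn; apply: (defect_lt (k := k)) => //=.
  by rewrite ffunE eqxx dimv_add_line // addnS.
- exact: componentwise_disjoint_growr.
(* The order matters: the branch with [v] in its first member comes first. *)
exists (s1 ++ s2).
rewrite !all_cat disj1 disj2 span1 span2 pairwise_cat meet1 meet2.
rewrite big_cat sum1 sum2 (weight_split vAB) !andbT; split=> //.
  rewrite (sub_all _ exts1) ?(sub_all _ exts2) // => q.
    exact: extends_trans.
  exact: extends_trans.
apply/allrelP=> q1 q2 /(allP exts1) ext1' /(allP exts2) ext2'.
apply: (meets_extends ext1' ext2'); apply/existsP; exists k => /=.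
(* [v] belongs to both grown members and is nonzero, being outside [A k]. *)
apply: contraNneq vA => cap0.
suff : v \in 0%VS by rewrite memv0 => /eqP->; apply: mem0v.
by rewrite -cap0 memv_cap !mem_grow.
Qed.

Lemma saturate_seq s :
  all componentwise_disjoint s -> pairwise meets s ->
  exists s', [/\ all componentwise_disjoint s', all spanning s',
    pairwise meets s' & \sum_(q <- s') weight q = \sum_(p <- s) weight p].
Proof.
move=> disj_s meet_s.
(* The induction also needs every new pair to extend an old one, so that pairs coming from different
   old pairs still meet. *)
suff [s' [disj' span' _ meet' sum']] : exists s',
    [/\ all componentwise_disjoint s', all spanning s',
      all (fun q => has (extends^~ q) s) s', pairwise meets s'
    & \sum_(q <- s') weight q = \sum_(p <- s) weight p] by exists s'.
elim: s disj_s meet_s => [_ _ | p s IHs /=].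
  by exists [::]; rewrite !big_nil.
move=> /andP[disj_p disj_s] /andP[meet_p meet_s].
have [t [disj_t span_t ext_t meet_t sum_t]] := saturate disj_p.
have [u [disj_u span_u ext_u meet_u sum_u]] := IHs disj_s meet_s.
exists (t ++ u).
rewrite !all_cat disj_t disj_u span_t span_u pairwise_cat meet_t meet_u.
rewrite big_cat big_cons sum_t sum_u !andbT; split=> //.
  rewrite (sub_all _ ext_t) ?(sub_all _ ext_u) // => q /= ext_q.
    by rewrite ext_q orbT.
  by rewrite ext_q.
apply/allrelP=> q q' /(allP ext_t) ext_q /(allP ext_u) /hasP[p' p's ext_q'].
by apply: (meets_extends ext_q ext_q'); apply: (allP meet_p).
Qed.

(** * Counting and weighing spanning pairs *)

Lemma size_spanning s (c : I -> nat) :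
  all componentwise_disjoint s -> all spanning s -> pairwise meets s ->
  (forall p k, p \in s -> \dim (p.1 k) = c k) ->
  (size s <= \prod_k 'C(\dim (V k), c k))%N.
Proof.
move=> disj_s span_s meet_s dim_s.
pose p0 : family * family := ([ffun=> 0%VS], [ffun=> 0%VS]).
pose P (i : 'I_(size s)) := nth p0 s i.
have Ps i : P i \in s by apply: mem_nth.
have disjP i k := forallP (allP disj_s _ (Ps i)) k.
have spanP i k := forallP (allP span_s _ (Ps i)) k.
have sAV i k : ((P i).1 k <= V k)%VS by case/and3P: (disjP i k).
have sBV i k : ((P i).2 k <= V k)%VS by case/and3P: (disjP i k).
have dimA i k : \dim ((P i).1 k) = c k by apply: dim_s.
have dimB i k : \dim (V k) = (c k + \dim ((P i).2 k))%N.
  by rewrite -(dimA i); apply/eqP.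
have [M MP] := fin_all_exists (fun k => complementary_pairing
  (sAV^~ k) (dimA^~ k) (sBV^~ k) (dimB^~ k)).
have prod_factors := factors_through_prod (fun k => (MP k).2).
apply: (factors_through_trig prod_factors) => [|i].
  (* Above the diagonal some component meets, so one factor of the product vanishes. *)
  apply/is_trig_mxP=> i j lt_ij; rewrite mxE.
  have /existsP[k cap_k] : meets (P i) (P j).
    by move/(pairwiseP p0): meet_s; apply; rewrite ?inE.
  apply/eqP; rewrite prodf_seq_eq0; apply/hasP; exists k => /=.
    exact: mem_index_enum.
  by rewrite -[_ == _]negbK (MP k).1.
rewrite mxE; apply/prodf_neq0 => k _; rewrite (MP k).1.
by case/and3P: (disjP i k).
Qed.

Lemma sum_weight_spanning s :
  all componentwise_disjoint s -> all spanning s -> pairwise meets s ->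
  \sum_(p <- s) weight p <= 1.
Proof.
move=> disj_s span_s meet_s.
(* The common bound [\dim {:vT}] makes the dimension vectors a finite type; values beyond
   [\dim (V k)] will contribute 0. *)
pose type p : {ffun I -> 'I_(\dim {:vT}).+1} :=
  [ffun k => inord (\dim (p.1 k))].
have typeE p k : type p k = \dim (p.1 k) :> nat.
  by rewrite ffunE inordK // ltnS dimvS ?subvf.
rewrite (partition_big type xpredT) //=.
pose w k c := 'C(\dim (V k), c)%:R * harmonic_weight F c (\dim (V k) - c).
have w_ge0 k c : 0 <= w k c.
  by rewrite mulr_ge0 ?ler0n ?harmonic_weight_ge0.
apply: (@le_trans _ _
  (\sum_(c : {ffun I -> 'I_(\dim {:vT}).+1}) \prod_k w k (c k))).
  apply: ler_sum => c _; set t := [seq p <- s | type p == c].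
  have subt p : p \in t -> p \in s by rewrite mem_filter => /andP[].
  have dim_t p k : p \in t -> \dim (p.1 k) = c k.
    by rewrite mem_filter => /andP[/eqP <- _]; rewrite typeE.
  have sub_all_t a : all a s -> all a t.
    by move=> /allP aP; apply/allP=> p /subt; apply: aP.
  have size_t : (size t <= \prod_k 'C(\dim (V k), c k))%N.
    apply: size_spanning => //; try exact: sub_all_t.
    exact: pairwise_filter.
  rewrite -big_filter -/t.
  rewrite (eq_big_seq (fun=>
    \prod_k harmonic_weight F (c k) (\dim (V k) - c k))).
    rewrite big_const_seq count_predT iter_addr_0 -mulr_natl.
    rewrite big_split /= -natr_prod.
    apply: ler_wpM2r; last by rewrite ler_nat.
    by apply: prodr_ge0 => k _; apply: harmonic_weight_ge0.
  move=> p pt; apply: eq_bigr => k _; rewrite (dim_t _ _ pt).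
  have /forallP/(_ k)/eqP -> := allP span_s _ (subt _ pt).
  by rewrite -(dim_t _ k pt) addKn.
(* By distributivity the sum over dimension vectors is a product over [k] of row sums. *)
rewrite -(bigA_distr_bigA (fun k (c : 'I_(\dim {:vT}).+1) => w k c)).
apply: prodr_ile1 => k _; apply/andP; split; first by apply: sumr_ge0.
have dimV : (\dim (V k) < (\dim {:vT}).+1)%N by rewrite ltnS dimvS ?subvf.
(* For [c] above [\dim (V k)] the binomial coefficient is 0, whatever the truncated subtraction in
   the weight gives. *)
rewrite (eq_bigr (fun c : 'I__ =>
  if (c < (\dim (V k)).+1)%N then (\dim (V k)).+1%:R^-1 else 0)); last first.
  move=> c _; case: ltnP => [le_cV | lt_Vc]; first exact: harmonic_weight_row.
  by rewrite /w bin_small ?mul0r.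
rewrite -big_mkcond -(big_ord_widen _ (fun=> (\dim (V k)).+1%:R^-1)) //.
by rewrite sumr_const card_ord -[_ *+ _]mulr_natl mulfV ?pnatr_eq0.
Qed.

Lemma sum_weight_le1 s :
  all componentwise_disjoint s -> pairwise meets s ->
  \sum_(p <- s) weight p <= 1.
Proof.
move=> disj_s meet_s.
have [s' [disj' span' meet' <-]] := saturate_seq disj_s meet_s.
exact: sum_weight_spanning.
Qed.

End SubspacePairs.

(** * From subspaces to their components *)

(** A nonzero common vector decomposes along [V] in only one way, so its components lie in both [A]
    and [B], and one of them is nonzero. *)
Lemma meet_component (K : fieldType) (vT : vectType K) (r : nat)
    (V : 'I_r -> {vspace vT}) (A B : {vspace vT}) :
  directv (\sum_(k < r) V k) ->
  A = (\sum_(k < r) (A :&: V k))%VS -> B = (\sum_(k < r) (B :&: V k))%VS ->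
  (A :&: B)%VS != 0%VS ->
  exists k, ((A :&: V k) :&: (B :&: V k))%VS != 0%VS.
Proof.
move=> /directv_sum_unique V_uniq defA defB.
rewrite -vpick0; set v := vpick _ => nz_v.
have := memv_pick (A :&: B)%VS; rewrite -/v memv_cap => /andP[vA vB].
have /memv_sumP[x xA def_x] : v \in (\sum_(k < r) (A :&: V k))%VS.
  by rewrite -defA.
have /memv_sumP[y yB def_y] : v \in (\sum_(k < r) (B :&: V k))%VS.
  by rewrite -defB.
have xV k : x k \in (A :&: V k)%VS by apply: xA.
have yV k : y k \in (B :&: V k)%VS by apply: yB.
have eq_xy k : x k = y k.
  have /eqP := def_x; rewrite {1}def_y eq_sym V_uniq.
  - by move=> /forallP/(_ k)/eqP.
  - by move=> l _; have := xV l; rewrite memv_cap => /andP[].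
  - by move=> l _; have := yV l; rewrite memv_cap => /andP[].
have [k nz_xk] : exists k, x k != 0.
  apply/existsP; apply: contraNT nz_v => /existsPn x0.
  by rewrite def_x big1 // => k _; apply/eqP; rewrite -[_ == _]negbK.
exists k; apply: contraNneq nz_xk => cap0.
by rewrite -memv0 -cap0 memv_cap xV eq_xy yV.
Qed.

Theorem theorem1p7 (R : realType) (vT : vectType R) (n r m : nat)
    (hn : \dim {: vT} = n)
    (V : 'I_r -> {vspace vT})
    (hV : is_direct_sum {: vT}%VS V)
    (A B : 'I_m -> {vspace vT})
    (hAB : skew_bollobas A B)
    (hA : forall i : 'I_m, is_direct_sum (A i) (fun k => (A i :&: V k)%VS))
    (hB : forall i : 'I_m, is_direct_sum (B i) (fun k => (B i :&: V k)%VS))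
    (a b : 'I_m -> 'I_r -> nat)
    (ha : forall i k, a i k = \dim (A i :&: V k))
    (hb : forall i k, b i k = \dim (B i :&: V k)) :
  \sum_(i < m)
    (\prod_(k < r) ('C(a i k + b i k, a i k)%:R * (1 + (a i k)%:R + (b i k)%:R)))^-1
  <= 1 :> R.
Proof.
have [disj skew] := hAB.
pose P i : {ffun 'I_r -> {vspace vT}} * {ffun 'I_r -> {vspace vT}} :=
  ([ffun k => (A i :&: V k)%VS], [ffun k => (B i :&: V k)%VS]).
have := @sum_weight_le1 R vT _ V R [seq P i | i <- enum 'I_m].
rewrite big_map big_enum /=.
rewrite (eq_bigr (fun i => (\prod_(k < r) ('C(a i k + b i k, a i k)%:R *
  (1 + (a i k)%:R + (b i k)%:R)))^-1)); last first.
  by move=> i _; rewrite -prodfV; apply: eq_bigr => k _; rewrite !ffunE ha hb.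
apply.
  apply/allP=> _ /mapP[i _ ->]; apply/forallP=> k.
  rewrite !ffunE !capvSr -subv0.
  have /eqP := disj i; rewrite dimv_eq0 => /eqP <-.
  by apply: capvS; apply: capvSl.
(* [enum 'I_m] is increasing, so condition (ii) covers each pair of entries in list order. *)
rewrite pairwise_map; apply: (@sub_pairwise _ (relpre val ltn)).
  move=> i j /skew; rewrite lt0n dimv_eq0 => nz_ij.
  have [k nz_k] := meet_component hV.2 (hA i).1 (hB j).1 nz_ij.
  by apply/existsP; exists k; rewrite !ffunE.
rewrite -pairwise_map val_enum_ord -sorted_pairwise ?iota_ltn_sorted //.
exact: ltn_trans.
Qed.
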